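(* Let $X$ be a compact metric space and let $\alpha,\beta:X\to X$ be a synchronously tame pair of commuting homeomorphisms such that $\beta^{-1}\alpha$ is expansive and satisfies specification. Then $$S^\infty(\alpha,\beta)=\exp\big(h(\beta^{-1}\alpha)\big).$$
   Context: $S(\alpha^n,\beta^n)=\{x\in X:\alpha^n(x)=\beta^n(x)\}$. The pair is synchronously tame if $\#S(\alpha^n,\beta^n)<\infty$ for all $n\ge1$. The growth rate is $S^\infty(\alpha,\beta)=\lim_{n\to\infty}(\#S(\alpha^n,\beta^n))^{1/n}$ (the equality includes existence of this limit). $h(f)$ denotes the topological entropy of $f$. A homeomorphism $f$ of a compact metric space $(X,d)$ is expansive if there is $\epsilon>0$ such that for any distinct $x,y\in X$ there is $n\in\mathbb Z$ with $d(f^n(x),f^n(y))>\epsilon$. $f$ satisfies specification if for each $\epsilon>0$ there is an integer $p(\epsilon)$ such that: given pairs $(x_1,I_1),\dots,(x_n,I_n)$, where $x_i\in X$ and $I_i$ are intervals of integers contained in $[a,b]$ with $d(I_i,I_j)\ge p(\epsilon)$ for $i\ne j$, there exists $x\in X$ with $f^{b-a+p(\epsilon)}(x)=x$ and $d(f^k(x),f^k(x_i))<\epsilon$ for all $k\in I_i$ and all $i=1,\dots,n$. *)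

(* Defs.v *)
From mathcomp Require Import all_boot all_order all_algebra.
From mathcomp Require Import finmap.
From mathcomp Require Import all_classical all_reals all_analysis.

Set Implicit Arguments.
Unset Strict Implicit.
Unset Printing Implicit Defensive.

Import Order.TTheory GRing.Theory Num.Theory.
Import numFieldNormedType.Exports.

Local Open Scope classical_set_scope.
Local Open Scope ring_scope.

Record homeo (X : topologicalType) := Homeo {
  homeo_fun :> X -> X;
  homeo_invfun : X -> X;
  homeo_funK : cancel homeo_fun homeo_invfun;
  homeo_invfunK : cancel homeo_invfun homeo_fun;
  homeo_fun_continuous : continuous homeo_fun;
  homeo_invfun_continuous : continuous homeo_invfun }.

Definition homeo_inv (X : topologicalType) (f : homeo X) : homeo X :=
  Homeo (@homeo_invfunK X f) (@homeo_funK X f)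
        (@homeo_invfun_continuous X f) (@homeo_fun_continuous X f).

Lemma continuous_comp_homeo (X : topologicalType) (f g : X -> X) :
  continuous f -> continuous g -> continuous (f \o g).
Proof. by move=> cf cg x; apply: continuous_comp; [exact: cg | exact: cf]. Qed.

Definition homeo_comp (X : topologicalType) (f g : homeo X) : homeo X :=
  Homeo (can_comp (@homeo_funK X f) (@homeo_funK X g))
        (can_comp (@homeo_invfunK X g) (@homeo_invfunK X f))
        (continuous_comp_homeo (@homeo_fun_continuous X f)
                               (@homeo_fun_continuous X g))
        (continuous_comp_homeo (@homeo_invfun_continuous X g)
                               (@homeo_invfun_continuous X f)).

(* [Negz n] denotes the integer -(n+1). *)
Definition iterz (X : topologicalType) (f : homeo X) (k : int) : X -> X :=
  match k with
  | Posz n => iter n f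
  | Negz n => iter n.+1 (homeo_inv f)
  end.

Definition sync_set (X : Type) (alpha beta : X -> X) (n : nat) : set X :=
  [set x | iter n alpha x = iter n beta x].

Definition synchronously_tame (X : Type) (alpha beta : X -> X) : Prop :=
  forall n : nat, (1 <= n)%N -> finite_set (sync_set alpha beta n).

(* [fset_set] is junk on infinite sets: meaningful for tame pairs, n >= 1. *)
Definition sync_number (X : choiceType) (alpha beta : X -> X) (n : nat) : nat :=
  #|` fset_set (sync_set alpha beta n) |%fset.

(* S^oo(alpha, beta) = s, including the existence of the limit as a real. *)
Definition growth_rate_is (R : realType) (X : choiceType) (alpha beta : X -> X)
    (s : R) : Prop :=
  ((sync_number alpha beta n)%:R : R) `^ (n%:R^-1) @[n --> \oo] --> s.

Section MetricDynamics.
Context {R : realType} {X : metricType R}.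

Definition expansive (f : homeo X) : Prop :=
  exists2 eps : R, 0 < eps & forall x y : X, x <> y ->
    exists n : int, eps < mdist (iterz f n x) (iterz f n y).

(* The i-th interval is I_i = {l i, ..., r i}, nonempty and inside [a, b];
   d(I_i, I_j) >= p is expressed on all pairs of elements. There is at least
   one pair (x_i, I_i), whence the index type 'I_m.+1. *)
Definition specification (f : homeo X) : Prop :=
  forall eps : R, 0 < eps -> exists p : int,
    forall (m : nat) (a b : int) (x : 'I_m.+1 -> X) (l r : 'I_m.+1 -> int),
      (forall i, [/\ a <= l i, l i <= r i & r i <= b]) ->
      (forall i j, i != j -> forall s t : int,
         l i <= s <= r i -> l j <= t <= r j -> p <= `|s - t|) ->
      exists y : X, iterz f (b - a + p) y = y /\
        forall i (k : int), l i <= k <= r i ->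
          mdist (iterz f k y) (iterz f k (x i)) < eps.

Definition separated (f : X -> X) (n : nat) (eps : R) (E : set X) : Prop :=
  forall x y : X, E x -> E y -> x <> y ->
    exists2 i : nat, (i < n)%N & eps < mdist (iter i f x) (iter i f y).

Definition max_separated (f : X -> X) (n : nat) (eps : R) : \bar R :=
  ereal_sup [set ((#|` E|%fset)%:R : R)%:E |
             E in [set E : {fset X} | separated f n eps [set` E]]].

Definition entropy_at (f : X -> X) (eps : R) : \bar R :=
  limn_esup (fun n : nat => ((n%:R^-1)%:E * lne (max_separated f n eps))%E).

(* Bowen's definition of the topological entropy of a continuous self-map of a
   compact metric space; the limit exists in \bar R since [entropy_at f] is
   nonincreasing in eps. *)
Definition topological_entropy (f : X -> X) : \bar R :=
  lim (entropy_at f eps @[eps --> 0^'+]).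

End MetricDynamics.

(* Main.v *)
(* Let f = beta^-1 alpha. Since alpha and beta commute, S(alpha^n, beta^n) is
   the set of fixed points of f^n; let N_n be its cardinality. Below the
   expansivity constant, fixed points of f^n are (n, eps)-separated, hence
   limsup (ln N_n) / n <= h(f, eps). Conversely, specification for a single
   interval shadows every orbit segment of length n - p by a fixed point of
   f^n; cutting a long orbit segment into blocks of length n - p gives
   h(f, 2 eps) <= (ln N_n) / (n - p). So (ln N_n) / n converges, and its limit
   is h(f, eps) for every small eps, which is finite because N_n is. *)
Require Import Defs.
From mathcomp Require Import all_boot all_order all_algebra.
From mathcomp Require Import finmap.
From mathcomp Require Import all_classical all_reals all_analysis.
From mathcomp Require Import zify lra.

Set Implicit Arguments.
Unset Strict Implicit.
Unset Printing Implicit Defensive.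

Import Order.TTheory GRing.Theory Num.Theory.
Import numFieldNormedType.Exports.

Local Open Scope classical_set_scope.
Local Open Scope ring_scope.

Lemma limn_esup_le (R : realType) (u : (\bar R)^nat) (c : \bar R) :
  (\forall n \near \oo, (u n <= c)%E) -> (limn_esup u <= c)%E.
Proof.
move=> uc; apply: ge_ereal_inf.
exists (ereal_sup (u @` [set n | (u n <= c)%E])).
  by exists [set n | (u n <= c)%E].
by apply: ge_ereal_sup => _ [n /= un <-].
Qed.

Lemma le_limn_esup (R : realType) (u v : (\bar R)^nat) :
  (\forall n \near \oo, (u n <= v n)%E) -> (limn_esup u <= limn_esup v)%E.
Proof.
move=> uv; apply: le_ereal_inf_tmp => _ [V Voo <-]; apply: ge_ereal_inf.
exists (ereal_sup (u @` (V `&` [set n | (u n <= v n)%E]))).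
  by exists (V `&` [set n | (u n <= v n)%E]) => //; exact: filterI.
apply: ge_ereal_sup => _ [n /= [Vn un] <-]; apply: le_trans un _.
by apply: ereal_sup_ubound; exists n.
Qed.

Lemma limn_esup_lt (R : realType) (u : (\bar R)^nat) (c : \bar R) :
  (limn_esup u < c)%E -> \forall n \near \oo, (u n < c)%E.
Proof.
move=> /ereal_inf_lt[_ [V Voo <-] Vc]; apply: filterS Voo => n Vn.
by apply: le_lt_trans Vc; apply: ereal_sup_ubound; exists n.
Qed.

(** Commutation makes [beta] commute with [f], so [alpha^n = beta^n f^n], and the injective [beta^n]
    can be cancelled. *)
Lemma sync_set_fixed (X : topologicalType) (alpha beta : homeo X) (n : nat) :
  (forall x, alpha (beta x) = beta (alpha x)) ->
  sync_set alpha beta n =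
  [set x | iter n (homeo_comp (homeo_inv beta) alpha) x = x].
Proof.
move=> comm; set f := homeo_comp _ _.
have bf x : beta (f x) = alpha x by rewrite /= homeo_invfunK.
have fb x : f (beta x) = beta (f x) by rewrite bf /= comm homeo_funK.
have fnb m x : iter m f (beta x) = beta (iter m f x).
  by elim: m => // m IHm; rewrite !iterS IHm fb.
have inj_beta : injective (iter n beta).
  elim: n => [x y //|n IHn x y /=] /(can_inj (@homeo_funK _ beta)).
  exact: IHn.
have iter_alpha x : iter n alpha x = iter n beta (iter n f x).
    by elim: n x {inj_beta} => // n IHn x; rewrite iterSr IHn -bf fnb -!iterSr.
apply/seteqP; split => x; rewrite /sync_set /= iter_alpha.
  exact: inj_beta.
by move->.
Qed.

Lemma iter_period (T : Type) (f : T -> T) (n k : nat) (x : T) :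
  iter n f x = x -> iter k f x = iter (k %% n)%N f x.
Proof.
move=> fx; rewrite {1}(divn_eq k n) addnC iterD; congr (iter _ f _).
by elim: (k %/ n)%N => // m IHm; rewrite mulSn iterD IHm.
Qed.

(** On points fixed by [f^n] the inverse acts as [f^(n-1)], so integer times reduce modulo [n]. The
    time [i] is chosen before [x], so that one [i] serves two periodic points at once. *)
Lemma iterz_period (X : topologicalType) (f : homeo X) (n : nat) (k : int) :
  (0 < n)%N -> exists2 i : nat, (i < n)%N &
    forall x, iter n f x = x -> iterz f k x = iter i f x.
Proof.
move=> n0; case: k => k.
  by exists (k %% n)%N; [rewrite ltn_mod|move=> x; exact: iter_period].
exists ((n.-1 * k.+1) %% n)%N; first by rewrite ltn_mod.
move=> x fx; rewrite -(iter_period _ fx).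
(* The exponents add up to [n * k.+1], a multiple of the period; the [k.+1] inverse steps of
   [Negz k] then undo the outer iterate. *)
have {1}-> : x = iter k.+1 f (iter (n.-1 * k.+1) f x).
  rewrite -iterD addnC -{1}[X in (_ + X)%N]mul1n -mulnDl addn1 prednK//.
  by rewrite (iter_period _ fx) modnMr.
rewrite /iterz; elim: k.+1 (iter _ f x) => // m IHm y.
by rewrite iterSr iterS /= homeo_funK IHm.
Qed.

(** Expansivity separates two fixed points of [f^n] at some integer time, which periodicity moves
    into [[0, n)]. *)
Lemma expansive_fixed_separated (R : realType) (X : metricType R) (f : homeo X) :
  expansive f -> exists2 eps0 : R, 0 < eps0 & forall (eps : R) (n : nat),
    eps <= eps0 -> (0 < n)%N -> Defs.separated f n eps [set x | iter n f x = x].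
Proof.
move=> [eps0 eps0_gt0 exp_f]; exists eps0 => // eps n le_eps n_gt0 x y fx fy xy.
have [k /(le_lt_trans le_eps)] := exp_f _ _ xy.
have [i i_n iterE] := iterz_period f k n_gt0.
by rewrite !iterE//; exists i.
Qed.

Lemma specification_periodic (R : realType) (X : metricType R) (f : homeo X)
    (eps : R) : specification f -> 0 < eps ->
  exists p : nat, forall n : nat, (p < n)%N -> forall x : X,
    exists2 y : X, iter n f y = y &
      forall i, (i < n - p)%N -> mdist (iter i f y) (iter i f x) < eps.
Proof.
move=> spec eps_gt0; have [p spec_p] := spec _ eps_gt0.
(* The specification constant may be negative, hence the absolute value. Since [n > |p|], [m] is
   [n - p]; on the single interval [[0, m]] the period [b - a + p] is then exactly [n]. *)
exists `|p|%N => n pn x; pose m := `|n%:Z - p|%N.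
have mE : m%:Z = n%:Z - p by rewrite /m; lia.
have [|i j|y [fy yx]] := spec_p 0%N 0 m%:Z (fun=> x) (fun=> 0) (fun=> m%:Z).
- by [].
- by rewrite !ord1 eqxx.
exists y; first by move: fy; rewrite subr0 mE subrK.
by move=> i im; apply: (yx ord0 i%:Z); lia.
Qed.

(* An orbit segment of length k * m is determined, up to 2 eps, by the k
   periodic points that shadow its consecutive blocks of length m. *)
Lemma card_separated_le (R : realType) (X : metricType R) (f : homeo X)
    (eps : R) (m k : nat) (E F : {fset X}) :
  (forall x : X, exists2 y : X, y \in F &
      forall i, (i < m)%N -> mdist (iter i f y) (iter i f x) < eps) ->
  (0 < m)%N -> Defs.separated f (k * m) (eps *+ 2) [set` E] ->
  (#|` E| <= #|` F| ^ k)%N.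
Proof.
move=> shadow m_gt0 sepE; have [s sF sx] : exists2 s : X -> X, forall x, s x \in F &
    forall x i, (i < m)%N -> mdist (iter i f (s x)) (iter i f x) < eps.
  exists (fun x => s2val (cid2 (shadow x))) => x; first by case: cid2.
  by case: cid2.
pose code (x : E) : {ffun 'I_k -> F} :=
  [ffun j : 'I_k => [` sF (iter (j * m) f (val x))]%fset].
suff code_inj : injective code.
  by have := leq_card _ code_inj; rewrite card_ffun card_ord -!cardfE.
move=> x y /ffunP codeE; apply/val_inj; apply: contrapT => xy.
(* The separating time [i] sits at offset [i %% m] of block [i %/ m]. Equal codes give both orbits
   the same shadowing point there, so the triangle inequality contradicts separation by [2 eps]. *)
have [i ik] := sepE _ _ (valP x) (valP y) xy.
have im : (i %/ m < k)%N by rewrite ltn_divLR.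
have := codeE (Ordinal im); rewrite !ffunE => /(congr1 val)/= sE.
have := sx (iter (i %/ m * m) f (val x)) (i %% m)%N.
have := sx (iter (i %/ m * m) f (val y)) (i %% m)%N.
rewrite sE -!iterD addnC -divn_eq ltn_mod => /(_ m_gt0) y_lt /(_ m_gt0) x_lt.
apply/negP; rewrite -leNgt mulr2n; apply: le_trans (ltW (ltrD x_lt y_lt)).
by rewrite [X in _ <= X + _]metric_sym metric_triangle.
Qed.

Lemma le_lne (R : realType) (x y : \bar R) : (x <= y)%E -> (lne x <= lne y)%E.
Proof.
move=> xy; have [x0|x0] := leP x 0%E; first by rewrite le0_lneNy// leNye.
have y0 := le_trans (ltW x0) xy.
by rewrite lee_lne// in_itv /= leey andbT// ltW.
Qed.

Lemma max_separated_ge (R : realType) (X : metricType R) (f : X -> X) (n : nat)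
    (eps : R) (E : {fset X}) : Defs.separated f n eps [set` E] ->
  ((#|` E|%:R : R)%:E <= max_separated f n eps)%E.
Proof. by move=> sepE; apply: ereal_sup_ubound; exists E. Qed.

Lemma separatedW (R : realType) (X : metricType R) (f : X -> X) (m n : nat)
    (eps : R) (E : set X) : (m <= n)%N ->
  Defs.separated f m eps E -> Defs.separated f n eps E.
Proof.
by move=> mn sepE x y Ex Ey /(sepE x y Ex Ey)[i /leq_trans/(_ mn) ? ?]; exists i.
Qed.

(** Counting codes bounds separated sets by [#F ^ (n/m + 1)]; after taking logarithms and dividing
    by [n], the extra block costs only [L / n], which tends to 0. *)
Lemma entropy_at_le_of_shadow (R : realType) (X : metricType R) (f : homeo X)
    (eps : R) (m : nat) (F : {fset X}) : (0 < #|` F|)%N -> (0 < m)%N ->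
  (forall x : X, exists2 y : X, y \in F &
      forall i, (i < m)%N -> mdist (iter i f y) (iter i f x) < eps) ->
  (entropy_at f (eps *+ 2) <= (m%:R^-1 * ln (#|` F|%:R : R))%:E)%E.
Proof.
move=> F_gt0 m_gt0 shadow; set L : R := ln _.
have L_ge0 : 0 <= L by rewrite ln_ge0// ler1n.
(* Rounding [n] up to a multiple of [m] preserves separation and gives whole blocks. *)
have max_le n :
    (max_separated f n (eps *+ 2) <= ((#|` F|%:R : R) ^+ (n %/ m).+1)%:E)%E.
  apply: ge_ereal_sup => _ [E /= sepE <-]; rewrite lee_fin -natrX ler_nat.
  apply: (card_separated_le shadow m_gt0); apply: (separatedW _ sepE).
  by rewrite ltnW// -ltn_divLR.
apply/lee_addgt0Pr => e e_gt0; apply: limn_esup_le.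
near=> n.
have n_gt0 : 0 < n%:R :> R by rewrite ltr0n; near: n; exact: nbhs_infty_gt.
apply: (@le_trans _ _
  ((n%:R^-1)%:E * lne ((#|` F|%:R ^+ (n %/ m).+1)%:E : \bar R))%E).
  by apply: lee_wpmul2l; [rewrite lee_fin invr_ge0 ltW|exact: le_lne].
rewrite lne_EFin ?exprn_gt0 ?ltr0n// lnXn ?ltr0n// -/L -EFinM -EFinD lee_fin.
rewrite ler_pdivrMl// mulrDr -[leLHS]mulr_natl -natr1 mulrDl mul1r lerD//.
  rewrite mulrA ler_wpM2r// ler_pdivlMr ?ltr0n// -natrM ler_nat.
  exact: leq_trunc_div.
rewrite -ler_pdivrMr//; near: n; exact: nbhs_infty_ger.
Unshelve. all: by end_near. Qed.

(** The lower bound reads [b n / n >= h - p h / n], whose error vanishes, while the upper limit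
    bounds [b n / n] from above. A single lower bound, at [p.+1], already forces [h] to be
    finite. *)
Lemma cvg_of_limn_esup_squeeze (R : realType) (b : nat -> R) (h : \bar R) (p : nat) :
  (forall n, 0 <= b n) ->
  (limn_esup (fun n => (n%:R^-1 * b n)%:E) <= h)%E ->
  (forall n, (p < n)%N -> (h <= ((n - p)%:R^-1 * b n)%:E)%E) ->
  exists2 r : R, h = r%:E & n%:R^-1 * b n @[n --> \oo] --> r.
Proof.
move=> b_ge0 esup_h h_le.
have h_ge0 : (0 <= h)%E.
  apply: le_trans esup_h; apply: limf_esup_ge0 => [[N _ /(_ N (leqnn N))]//|n].
  by rewrite lee_fin mulr_ge0// invr_ge0.
have h_fin : h \is a fin_num.
  by rewrite ge0_fin_numE//; apply: le_lt_trans (h_le p.+1 _) (ltry _).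
exists (fine h); first by rewrite fineK.
move: h_fin h_ge0 esup_h h_le => /fineK <-; set r := fine h; rewrite lee_fin /=.
move=> r_ge0 esup_r r_le; apply/cvgrPdist_le => e e_gt0.
have /limn_esup_lt : (limn_esup (fun n => (n%:R^-1 * b n)%:E) < (r + e)%:E)%E.
  by apply: le_lt_trans esup_r _; rewrite lte_fin ltrDl.
apply: filter_app; near=> n => lt_re.
have pn : (p < n)%N by near: n; exact: nbhs_infty_gt.
have n_gt0 : 0 < n%:R :> R by rewrite ltr0n (leq_ltn_trans _ pn).
have {}lt_re : n%:R^-1 * b n < r + e by rewrite -lte_fin.
rewrite distrC ler_distl (ltW lt_re) andbT.
have := r_le _ pn; rewrite lee_fin ler_pdivlMl ?ltr0n ?subn_gt0// natrB ?(ltnW pn)//.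
have : r * p%:R <= e * n%:R.
  rewrite mulrC -ler_pdivrMl// mulrC.
  by near: n; exact: nbhs_infty_ger.
by rewrite ler_pdivlMl//; nra.
Unshelve. all: by end_near. Qed.

Theorem theorem41 (R : realType) (X : metricType R) (alpha beta : homeo X)
  (X_compact : compact [set: X])
  (alpha_beta_commute : forall x : X, alpha (beta x) = beta (alpha x))
  (alpha_beta_tame : synchronously_tame alpha beta)
  (quotient_expansive : expansive (homeo_comp (homeo_inv beta) alpha))
  (quotient_spec : specification (homeo_comp (homeo_inv beta) alpha)) :
  exists s : R, growth_rate_is alpha beta s /\
    s%:E = expeR (topological_entropy (homeo_comp (homeo_inv beta) alpha)).
Proof.
set f := homeo_comp _ _ in quotient_expansive quotient_spec *.
(* On the empty space every count is 0 and the entropy is [-oo], so both sides are 0; [n > 0] avoids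
   the degenerate exponent and the product [0 * -oo]. *)
have [[x0 _]|X0] := pselect (exists x : X, True); last first.
  have empty_fset (E : {fset X}) : #|` E| = 0%N.
    apply/eqP; rewrite cardfs_eq0; apply/eqP/fsetP => x.
    by case: X0; exists x.
  exists 0; split.
    apply: cvg_near_cst; near=> n.
    rewrite /sync_number empty_fset powR0// invr_eq0 pnatr_eq0 -lt0n.
    by near: n; exact: nbhs_infty_gt.
  suff -> : topological_entropy f = -oo%E by [].
  apply: cvg_lim => //; apply: cvg_near_cst; apply: nearW => eps.
  apply/eqP; rewrite -leeNy_eq; apply: limn_esup_le; near=> n.
  have n_gt0 : (0 < n)%N by near: n; exact: nbhs_infty_gt.
  rewrite le0_lneNy; first by rewrite mulrNy gtr0_sg ?invr_gt0 ?ltr0n// mul1e.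
  by apply: ge_ereal_sup => _ [E _ <-]; rewrite empty_fset.
pose F n := fset_set (sync_set alpha beta n).
have FP n y : (0 < n)%N -> reflect (iter n f y = y) (y \in F n).
  move=> n_gt0; rewrite in_fset_set; last exact: alpha_beta_tame.
  by apply: (iffP idP); rewrite in_setE (sync_set_fixed _ alpha_beta_commute).
pose b n : R := ln (#|` F n|%:R).
(* By convention [ln 0 = 0], which covers any [n] for which [F n] is empty. *)
have b_ge0 n : 0 <= b n.
  by rewrite /b; case: #|` F n| => [|k]; [rewrite ln0|rewrite ln_ge0// ler1n].
have [eps0 eps0_gt0 sep_fixed] := expansive_fixed_separated quotient_expansive.
have shadow eps : 0 < eps -> exists p, forall n, (p < n)%N -> forall x,
    exists2 y, y \in F n & forall i, (i < n - p)%N ->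
      mdist (iter i f y) (iter i f x) < eps.
  move=> /(specification_periodic quotient_spec)[p sp]; exists p => n pn x.
  have [y fy yx] := sp n pn x; exists y => //.
  by apply/FP => //; exact: leq_ltn_trans pn.
(* Shadowing [x0] produces a periodic point. Nonemptiness matters because [ln], [lne] and [powR]
   treat 0 by different conventions. *)
have F_gt0 : \forall n \near \oo, (0 < #|` F n|)%N.
  have [p sp] := shadow 1 ltr01; near=> n.
  have [|y yF _] := sp n _ x0; first by near: n; exact: nbhs_infty_gt.
  by rewrite cardfs_gt0; apply/fset0Pn; exists y.
have entropy_eps eps : 0 < eps -> eps <= eps0 ->
    exists2 r : R, entropy_at f eps = r%:E & n%:R^-1 * b n @[n --> \oo] --> r.
  move=> eps_gt0 le_eps.
  (* Coding by shadowing points loses a factor 2 in the scale. *)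
  have [p sp] := shadow (eps / 2) (divr_gt0 eps_gt0 (ltr0n _ 2)).
  apply: (@cvg_of_limn_esup_squeeze _ b _ p) => // [|n pn].
    apply: le_limn_esup; near=> n.
    have n_gt0 : (0 < n)%N by near: n; exact: nbhs_infty_gt.
    rewrite EFinM lee_wpmul2l ?lee_fin ?invr_ge0//.
    rewrite -lne_EFin; last by rewrite ltr0n; near: n.
    apply/le_lne/max_separated_ge => x y /= /FP fx /FP fy.
    by apply: sep_fixed => //; [exact: fx|exact: fy].
  have -> : eps = (eps / 2) *+ 2 by rewrite -mulr_natr divfK.
  have [y yF _] := sp n pn x0.
  apply: entropy_at_le_of_shadow; [|by rewrite subn_gt0|exact: sp].
  by rewrite cardfs_gt0; apply/fset0Pn; exists y.
have [r _ br] := entropy_eps _ eps0_gt0 (lexx _).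
exists (expR r); split.
  have : expR (n%:R^-1 * b n) @[n --> \oo] --> expR r.
    by apply: continuous_cvg br; exact: continuous_expR.
  apply: cvg_trans; apply: near_eq_cvg; near=> n => /=.
  rewrite /powR pnatr_eq0 ifF//; apply/negbTE; rewrite -lt0n; near: n.
  exact: F_gt0.
(* The sequence [b n / n] does not involve [eps], so uniqueness of its limit makes [entropy_at f]
   constant on [(0, eps0]]. *)
suff -> : topological_entropy f = r%:E by [].
apply: cvg_lim => //; apply: cvg_near_cst; near=> eps.
have eps_gt0 : 0 < eps by near: eps; exact: nbhs_right_gt.
have le_eps : eps <= eps0 by near: eps; exact: nbhs_right_le.
have [r' -> br'] := entropy_eps eps eps_gt0 le_eps.
by congr EFin; exact: (cvg_unique _ br' br).
Unshelve. all: by end_near. Qed.
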